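(* (Type $q$-P$(A_5)^\#$.) Let $Y(x)={}^t(y_1(x),y_2(x))$ be meromorphic on $\mathbb{C}^*$ and satisfy $Y(qx)=A(x)Y(x)$ with the matrix $A(x)$ of the context, and suppose $\lambda=a_3$. Then $$y_1(q^2x)-(q^2\kappa_1x^2-dx+\theta_1t)y_1(qx)+\kappa_1\kappa_2x(qx-a_3)(x-a_1t)y_1(x)=0,$$ $$d=q\kappa_1a_3+\frac{q\theta_1t}{a_3}-\frac{a_3-a_1t}{\mu}.$$ Moreover, if $u$ is a meromorphic function on $\mathbb{C}^*$, not identically zero, with $u(qx)=(x-a_1t)u(x)$, then $f(x)=y_1(qx)/u(qx)$ satisfies $$(qx-a_1t)f(qx)-(q^2\kappa_1x^2-dx+\theta_1t)f(x)+\kappa_1\kappa_2x(qx-a_3)f(x/q)=0.$$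
   Context: Let $q,t,\kappa_1,\kappa_2,a_1,a_3,\theta_1,\lambda,\mu,\omega$ be nonzero complex numbers. The matrix is $$A(x)=\begin{pmatrix}\kappa_1\{(x-\lambda)(x-\alpha)+\mu_1\}&\omega(x-\lambda)\\ \kappa_1\omega^{-1}(\gamma x+\delta)&\kappa_2(x-\lambda)+\mu_2\end{pmatrix},$$ $$\mu_1=\frac{\lambda(\lambda-a_1t)}{q\kappa_1\mu},\quad \mu_2=q\kappa_1\kappa_2\mu(\lambda-a_3),\quad \alpha=\frac{\lambda^{-1}(\theta_1t-\kappa_1\mu_1-\mu_2)+\kappa_2}{\kappa_1},$$ $$\gamma=\mu_2-\kappa_2(2\lambda+\alpha-a_1t-a_3),\quad \delta=\lambda^{-1}(\alpha\lambda+\mu_1)(\kappa_2\lambda-\mu_2).$$ (This is the linear system of Murata's Lax form for the $q$-Painlevé equation of type $A_5^\#$; it satisfies $\det A(x)=\kappa_1\kappa_2x(x-a_1t)(x-a_3)$.) Equations are understood as identities of meromorphic functions. *)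

(* Defs.v *)
From HB Require Import structures.
From mathcomp Require Import all_boot all_order all_algebra.
From mathcomp Require Import complex.
From mathcomp Require Import all_classical all_reals all_analysis.

Set Implicit Arguments.
Unset Strict Implicit.
Unset Printing Implicit Defensive.

Import Order.TTheory GRing.Theory Num.Theory.
Import numFieldNormedType.Exports.

Local Open Scope classical_set_scope.
Local Open Scope ring_scope.

(* The topology and norm of [numFieldType]s are keyed on the structure, not on
   the carrier, so they are not found on a bare [R[i]]. *)
Definition Cplx (R : realType) : numClosedFieldType := R[i].

Definition punctured_plane (R : realType) : set (Cplx R) := [set z | z != 0].

(* [derivable] over the field [Cplx R] takes the limit of the difference
   quotient along complex increments: it is complex differentiability. *)
Definition holomorphic_at (R : realType) (g : Cplx R -> Cplx R) (z0 : Cplx R)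
  : Prop := \forall z \near z0, derivable g z 1.

(* Functions are total: the value at a pole, or at any other isolated point,
   is irrelevant.  Near every point of [U], including the poles, [f] is
   holomorphic up to a pole of order at most [n]. *)
Definition meromorphic_on (R : realType) (U : set (Cplx R))
    (f : Cplx R -> Cplx R) : Prop :=
  forall z0, U z0 -> exists n : nat, exists g : Cplx R -> Cplx R,
    holomorphic_at g z0 /\
    \forall z \near z0^', f z = g z / (z - z0) ^+ n.

(* Equality of meromorphic functions on [U]: equality off a set without
   accumulation points in [U].  The codomain is arbitrary so that vector-valued
   functions can be compared. *)
Definition mero_eq (R : realType) (T : Type) (U : set (Cplx R))
    (f g : Cplx R -> T) : Prop :=
  forall z0, U z0 -> \forall z \near z0^', f z = g z.

Definition mx22 (C : Type) (a b c d : C) : 'M[C]_2 :=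
  \matrix_(i < 2, j < 2)
    if i == 0 then (if j == 0 then a else b) else (if j == 0 then c else d).

Definition lax_matrix (C : fieldType)
    (q t kappa1 kappa2 a1 a3 theta1 lambda mu omega : C) (x : C) : 'M[C]_2 :=
  let mu1 := lambda * (lambda - a1 * t) / (q * kappa1 * mu) in
  let mu2 := q * kappa1 * kappa2 * mu * (lambda - a3) in
  let alpha :=
    (lambda^-1 * (theta1 * t - kappa1 * mu1 - mu2) + kappa2) / kappa1 in
  let gamma := mu2 - kappa2 * (2 * lambda + alpha - a1 * t - a3) in
  let delta :=
    lambda^-1 * (alpha * lambda + mu1) * (kappa2 * lambda - mu2) in
  mx22 (kappa1 * ((x - lambda) * (x - alpha) + mu1))
       (omega * (x - lambda))
       (kappa1 * omega^-1 * (gamma * x + delta))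
       (kappa2 * (x - lambda) + mu2).

(* Main.v *)
Require Import Defs.
From HB Require Import structures.
From mathcomp Require Import all_boot all_order all_algebra.
From mathcomp Require Import complex.
From mathcomp Require Import all_classical all_reals all_analysis.
From mathcomp Require Import ring.
Set Implicit Arguments.
Unset Strict Implicit.
Unset Printing Implicit Defensive.

Import Order.TTheory GRing.Theory Num.Theory.
Import numFieldNormedType.Exports.
Local Open Scope classical_set_scope.
Local Open Scope ring_scope.

(** Multiplication by [q] is continuous, and injectivity keeps the puncture: [z != z0] gives
    [q * z != q * z0]. This transports an equation valid near [q * z0] back to [z0]. *)
Lemma dnbhs_mull (K : numFieldType) (q z0 : K) (P : set K) : q != 0 ->
  (\forall z \near (q * z0)^', P z) -> \forall z \near z0^', P (q * z).
Proof.
move=> q0; rewrite !near_withinE => Pq.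
have mulq_cvg : (fun z : K => q * z) z @[z --> z0] --> q * z0.
  exact: mulrl_continuous.
apply: (@filterS _ (nbhs z0) _ _ _ _ (mulq_cvg _ Pq)) => z /= Pz z_neq; apply: Pz.
by rewrite (inj_eq (mulfI q0)).
Qed.

Lemma dnbhs_avoid (K : numFieldType) (z0 c : K) :
  \forall z \near z0^', z != c.
Proof.
have [<-|z0c] := eqVneq z0 c; first exact: nbhs_dnbhs_neq.
have c_open : open (~` [set c]).
  exact/closed_openC/accessible_closed_set1/hausdorff_accessible/norm_hausdorff.
have z0_nbhs : nbhs z0 (~` [set c]).
  by apply: open_nbhs_nbhs; split=> // /= z0E; rewrite z0E eqxx in z0c.
by apply: filterS (nbhs_dnbhs z0_nbhs) => z /= /eqP.
Qed.

(* With [lambda = a3] the entry [mu2] vanishes, so [x - a3] divides the second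
   column of the matrix and [y2] can be eliminated without dividing by it: the
   coefficient of [y1 x] is [(q * x - a3) * (\det (A x) / (x - a3))]. *)
Lemma lax_eliminate (K : fieldType)
    (q t kappa1 kappa2 a1 a3 theta1 mu omega x : K) (Y : K -> 'cV[K]_2) :
  q != 0 -> kappa1 != 0 -> a3 != 0 -> mu != 0 -> omega != 0 ->
  let A := lax_matrix q t kappa1 kappa2 a1 a3 theta1 a3 mu omega in
  Y (q * x) = A x *m Y x -> Y (q * (q * x)) = A (q * x) *m Y (q * x) ->
  Y (q ^+ 2 * x) 0 0
    - (q ^+ 2 * kappa1 * x ^+ 2
       - (q * kappa1 * a3 + q * theta1 * t / a3 - (a3 - a1 * t) / mu) * x
       + theta1 * t) * Y (q * x) 0 0
    + kappa1 * kappa2 * x * (q * x - a3) * (x - a1 * t) * Y x 0 0 = 0.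
Proof.
move=> q0 k10 a30 mu0 om0 A Yx Yqx.
have ord1E : lift ord0 ord0 = 1 :> 'I_2 by apply: val_inj.
have y1qq : Y (q ^+ 2 * x) 0 0 =
    A (q * x) 0 0 * Y (q * x) 0 0 + A (q * x) 0 1 * Y (q * x) 1 0.
  by rewrite expr2 -mulrA Yqx mxE !big_ord_recl big_ord0 addr0 !ord1E.
have y1q : Y (q * x) 0 0 = A x 0 0 * Y x 0 0 + A x 0 1 * Y x 1 0.
  by rewrite Yx mxE !big_ord_recl big_ord0 addr0 !ord1E.
have y2q : Y (q * x) 1 0 = A x 1 0 * Y x 0 0 + A x 1 1 * Y x 1 0.
  by rewrite Yx mxE !big_ord_recl big_ord0 addr0 !ord1E.
(* Everything is now linear in [Y x 0 0] and [Y x 1 0]. The coefficient of [Y x 1 0] vanishes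
   because the trace of [A (q * x)] is [q ^+ 2 * kappa1 * x ^+ 2 - d * x + theta1 * t], with [d] as
   in the theorem; that of [Y x 0 0] then vanishes by the determinant formula. *)
rewrite y1qq y2q y1q {y1qq y1q y2q Yx Yqx}.
rewrite /A !mxE /=.
by field; rewrite q0 k10 a30 mu0 om0.
Qed.

Theorem mainTheorem5 (R : realType)
    (q t kappa1 kappa2 a1 a3 theta1 lambda mu omega : Cplx R)
    (q_neq0 : q != 0) (t_neq0 : t != 0)
    (kappa1_neq0 : kappa1 != 0) (kappa2_neq0 : kappa2 != 0)
    (a1_neq0 : a1 != 0) (a3_neq0 : a3 != 0) (theta1_neq0 : theta1 != 0)
    (lambda_neq0 : lambda != 0) (mu_neq0 : mu != 0) (omega_neq0 : omega != 0)
    (Y : Cplx R -> 'cV[Cplx R]_2)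
    (Y_mero : forall i, meromorphic_on (@punctured_plane R) (fun x => Y x i 0))
    (Y_eq : mero_eq (@punctured_plane R)
       (fun x => Y (q * x))
       (fun x => lax_matrix q t kappa1 kappa2 a1 a3 theta1 lambda mu omega x
                   *m Y x))
    (lambda_a3 : lambda = a3) :
  let y1 := fun x => Y x 0 0 in
  let d := q * kappa1 * a3 + q * theta1 * t / a3 - (a3 - a1 * t) / mu in
  mero_eq (@punctured_plane R)
    (fun x => y1 (q ^+ 2 * x)
       - (q ^+ 2 * kappa1 * x ^+ 2 - d * x + theta1 * t) * y1 (q * x)
       + kappa1 * kappa2 * x * (q * x - a3) * (x - a1 * t) * y1 x)
    (fun=> 0)
  /\
  forall u : Cplx R -> Cplx R,
    meromorphic_on (@punctured_plane R) u ->
    ~ mero_eq (@punctured_plane R) u (fun=> 0) ->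
    mero_eq (@punctured_plane R)
      (fun x => u (q * x)) (fun x => (x - a1 * t) * u x) ->
    let f := fun x => y1 (q * x) / u (q * x) in
    mero_eq (@punctured_plane R)
      (fun x => (q * x - a1 * t) * f (q * x)
         - (q ^+ 2 * kappa1 * x ^+ 2 - d * x + theta1 * t) * f x
         + kappa1 * kappa2 * x * (q * x - a3) * f (x / q))
      (fun=> 0).
Proof.
subst lambda => y1 d.
have y1_eq : mero_eq (@punctured_plane R)
    (fun x => y1 (q ^+ 2 * x)
       - (q ^+ 2 * kappa1 * x ^+ 2 - d * x + theta1 * t) * y1 (q * x)
       + kappa1 * kappa2 * x * (q * x - a3) * (x - a1 * t) * y1 x)
    (fun=> 0).
  move=> z0 z0_neq0.
  have qz0_neq0 : q * z0 != 0 by rewrite mulf_neq0.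
  (* The elimination iterates the system twice; its second use, at [q * x], comes from the equation
     near [q * z0]. *)
  have := dnbhs_mull q_neq0 (Y_eq _ qz0_neq0).
  by apply: filterS2 (Y_eq _ z0_neq0) => x Yx Yqx; apply: lax_eliminate Yx Yqx.
split=> // u _ _ u_eq f z0 z0_neq0.
have qz0_neq0 : q * z0 != 0 by rewrite mulf_neq0.
have u_qx := dnbhs_mull q_neq0 (u_eq _ qz0_neq0).
(* The factors [x - a1 * t] and [q * x - a1 * t] get cancelled below; each vanishes at a single
   point, which a punctured neighbourhood can avoid. *)
have x_neq := dnbhs_avoid z0 (a1 * t).
have qx_neq := dnbhs_mull q_neq0 (dnbhs_avoid (q * z0) (a1 * t)).
apply: filterS3 (filterI x_neq qx_neq) (y1_eq _ z0_neq0)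
  (filterI u_qx (u_eq _ z0_neq0)) => x [].
rewrite -2!(subr_eq0 _ (a1 * t)) => x1 qx1 y1x [uqx ux].
(* Zeros of [u] need no exclusion: as [0^-1 = 0], inversion is multiplicative
   there too, and all three terms vanish. *)
have fqx : (q * x - a1 * t) * f (q * x) = y1 (q ^+ 2 * x) / u (q * x).
  by rewrite /f uqx invfM mulrCA mulVKf // expr2 mulrA.
have fxq : f (x / q) = (x - a1 * t) * y1 x / u (q * x).
  by rewrite /f [q * _]mulrC divfK // ux invfM mulrACA divff // mul1r.
(* All terms now share the denominator [u (q * x)], so the claim is the equation for [y1] divided by
   it. *)
rewrite fqx fxq /f -[RHS](mul0r (u (q * x))^-1) -y1x; ring.
Qed.
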